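(* There are infinitely many (pairwise non-isomorphic) $4$-critical $P_7$-free graphs.
   Context: All graphs are finite, simple and undirected. $P_t$ denotes the path on $t$ vertices. A graph is $k$-colorable if it admits a proper vertex coloring with $k$ colors, and $k$-chromatic if it is $k$-colorable but not $(k-1)$-colorable. A graph is $H$-free if it does not contain $H$ as an induced subgraph. A graph $G$ is called $k$-critical $H$-free if $G$ is $H$-free, $G$ is $k$-chromatic, and every $H$-free proper subgraph of $G$ (subgraphs are not required to be induced) is $(k-1)$-colorable. *)

(* Defs.v *)
From mathcomp Require Import all_boot.

Set Implicit Arguments.
Unset Strict Implicit.
Unset Printing Implicit Defensive.

Record sgraph := SGraph {
  vertex :> finType;
  edge : rel vertex;
  edge_sym : symmetric edge;
  edge_irr : irreflexive edge }.

Definition isomorphic (G H : sgraph) : Prop :=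
  exists f : G -> H, bijective f /\ forall x y, edge (f x) (f y) = edge x y.

Definition path_rel (t : nat) : rel 'I_t :=
  fun i j => (i.+1 == j) || (j.+1 == i).

Lemma path_rel_sym t : symmetric (@path_rel t).
Proof. by move=> i j; rewrite /path_rel orbC. Qed.

Lemma path_rel_irr t : irreflexive (@path_rel t).
Proof. by move=> i; rewrite /path_rel -[_ == _]negbK neq_ltn ltnSn orbT. Qed.

(* The index counts vertices, so [path_graph t] has t - 1 edges. *)
Definition path_graph (t : nat) : sgraph :=
  SGraph (@path_rel_sym t) (@path_rel_irr t).

Section Subgraphs.
Variable G : sgraph.

Definition induced_rel (S : {set G}) : rel {x : G | x \in S} :=
  fun x y => edge (val x) (val y).

Lemma induced_rel_sym S : symmetric (@induced_rel S).
Proof. by move=> x y; rewrite /induced_rel edge_sym. Qed.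

Lemma induced_rel_irr S : irreflexive (@induced_rel S).
Proof. by move=> x; rewrite /induced_rel edge_irr. Qed.

Definition induced (S : {set G}) : sgraph :=
  SGraph (@induced_rel_sym S) (@induced_rel_irr S).

(* A subgraph, not necessarily induced.  By symmetry of [sub_edge], the
   condition [sub_edge_vert] puts both ends of an edge in [sub_vert]. *)
Record subgraph := Subgraph {
  sub_vert : {set G};
  sub_edge : rel G;
  sub_edge_sym : symmetric sub_edge;
  sub_edge_vert : forall x y, sub_edge x y -> x \in sub_vert;
  sub_edge_edge : forall x y, sub_edge x y -> edge x y }.

Definition subgraph_rel (K : subgraph) : rel {x : G | x \in sub_vert K} :=
  fun x y => sub_edge K (val x) (val y).

Lemma subgraph_rel_sym K : symmetric (@subgraph_rel K).
Proof. by move=> x y; rewrite /subgraph_rel sub_edge_sym. Qed.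

Lemma subgraph_rel_irr K : irreflexive (@subgraph_rel K).
Proof.
move=> x; apply/negP => /sub_edge_edge.
by rewrite edge_irr.
Qed.

Definition sgraph_of_subgraph (K : subgraph) : sgraph :=
  SGraph (@subgraph_rel_sym K) (@subgraph_rel_irr K).

Definition proper_subgraph (K : subgraph) : Prop :=
  (exists x, x \notin sub_vert K) \/
  (exists x y, edge x y /\ ~~ sub_edge K x y).

End Subgraphs.

Coercion sgraph_of_subgraph : subgraph >-> sgraph.

Definition colorable (k : nat) (G : sgraph) : Prop :=
  exists c : G -> 'I_k, forall x y, edge x y -> c x != c y.

(* Meant for k >= 1, because of the truncated predecessor; the same holds for
   [critical_free]. *)
Definition chromatic (k : nat) (G : sgraph) : Prop :=
  colorable k G /\ ~ colorable k.-1 G.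

Definition free (H G : sgraph) : Prop :=
  ~ exists S : {set G}, isomorphic (induced S) H.

(* G is k-critical H-free: only the H-free proper subgraphs are required to be
   (k-1)-colorable. *)
Definition critical_free (k : nat) (H G : sgraph) : Prop :=
  [/\ free H G,
      chromatic k G
    & forall K : subgraph G,
        proper_subgraph K -> free H K -> colorable k.-1 K].

Definition infinitely_many_up_to_iso (P : sgraph -> Prop) : Prop :=
  exists F : nat -> sgraph,
    (forall n, P (F n)) /\ (forall m n, m <> n -> ~ isomorphic (F m) (F n)).

(* Main.v *)
Require Import Defs.
From mathcomp Require Import all_boot.
From mathcomp Require Import zify.
From Stdlib Require Import Classical ClassicalEpsilon.

Set Implicit Arguments.
Unset Strict Implicit.
Unset Printing Implicit Defensive.

(* The circulant graph on Z/(3r+4) joining i to i +- 1 and to i + 3j + 2 for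
   0 <= j <= r consists of vertices i, i+1, i+2 pairwise adjacent, so a
   3-colouring would be constant on 0, 3, ..., 3r+3, whose ends are adjacent.
   Cutting the circle at a vertex v identifies the remaining vertices with an
   interval of integers in which adjacent x < y satisfy y = x + 1 or
   y = x + 2 mod 3.  There the residue mod 3 is a proper 3-colouring, and
   no seven integers induce a P_7.  The circulant graphs are not edge-critical
   in general (for r = 1 one gets a graph properly containing the Moser
   spindle), but all their vertices are needed: a P_7-free non-3-colourable
   subgraph with fewest edges is spanning and 4-critical P_7-free. *)

Section CriticalSubgraph.
Variables (k : nat) (H : sgraph).

(** The colouring is total, with an arbitrary value at [v], so that it restricts directly to
    subgraphs. *)
Definition vertex_deletions_colorable (G : sgraph) : Prop :=
  forall v : G, exists c : G -> 'I_k,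
    forall x y, x != v -> y != v -> edge x y -> c x != c y.

Lemma vertex_deletions_colorableS (G : sgraph) :
  vertex_deletions_colorable G -> colorable k.+1 G.
Proof.
move=> delG; have [[v _]|noG] := classic (exists v : G, True); last first.
  by exists (fun=> ord0) => x; case: noG; exists x.
have [c cP] := delG v.
exists (fun x => if x == v then ord_max else widen_ord (leqnSn k) (c x)).
have ltc x : nat_of_ord (c x) == k = false by rewrite ltn_eqF.
move=> x y exy; case: (eqVneq x v) (eqVneq y v) => [xv|nxv] [yv|nyv].
- by rewrite xv yv edge_irr in exy.
- by rewrite -val_eqE /= eq_sym ltc.
- by rewrite -val_eqE /= ltc.
- by rewrite -val_eqE /=; apply: cP.
Qed.

Definition arcs (G : sgraph) : {set G * G} := [set p | edge p.1 p.2].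

Lemma card_spanning_arcs (G : sgraph) (K : subgraph G) (x y : G) :
  edge x y -> ~~ sub_edge K x y -> #|arcs K| < #|arcs G|.
Proof.
move=> exy nKxy.
pose f (p : K * K) : G * G := (val p.1, val p.2).
have f_inj : injective f.
  by move=> [a b] [a' b'] [/val_inj -> /val_inj ->].
rewrite -(card_imset (arcs K) f_inj); apply: proper_card; apply/properP; split.
  apply/subsetP => _ /imsetP [p pK ->].
  by rewrite inE in pK; rewrite inE; apply: sub_edge_edge pK.
exists (x, y); first by rewrite inE.
apply/imsetP => -[p pK [ex ey]].
by rewrite inE in pK; rewrite ex ey in nKxy; case/negP: nKxy.
Qed.

(** Descent on the number of arcs. A subgraph that is not [k]-colorable cannot miss a vertex [x],
    since a colouring of [G] without [x] would restrict to it; so it misses an edge, and it inherits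
    the deletion colourings. The order of [G'] is recorded to tell the final graphs apart. *)
Lemma exists_critical_free (G : sgraph) :
    free H G -> ~ colorable k G -> vertex_deletions_colorable G ->
  exists G' : sgraph, critical_free k.+1 H G' /\ #|G'| = #|G|.
Proof.
have [m] := ubnP #|arcs G|; elim: m G => // m IHm G ltGm freeG ncolG delG.
have [critG|ncritG] := classic (critical_free k.+1 H G); first by exists G.
have [K [properK freeK ncolK]] : exists K : subgraph G,
    [/\ proper_subgraph K, free H K & ~ colorable k K].
  apply: NNPP => noK; apply: ncritG; split=> //.
    by split=> //; apply: vertex_deletions_colorableS.
  by move=> K pK fK; apply: NNPP => ncK; apply: noK; exists K.
have spanK x : x \in sub_vert K.
  apply/negPn/negP => nKx; have [c cP] := delG x; apply: ncolK.
  exists (fun u : K => c (val u)) => u w euw.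
  by apply: cP (sub_edge_edge euw); apply: contraNneq nKx => <-; apply: valP.
case: properK => [[x]|[x [y [exy nKxy]]]]; first by rewrite spanK.
have [||||G' [critG' cardG']] := IHm K => //.
- rewrite -ltnS; apply: leq_ltn_trans ltGm.
  exact: card_spanning_arcs exy nKxy.
- move=> v; have [c cP] := delG (val v).
  exists (fun u : K => c (val u)) => u w nuv nwv euw.
  by apply: cP (sub_edge_edge euw); rewrite val_eqE.
- exists G'; split=> //; rewrite cardG' card_sig.
  by apply: eq_card => x'; rewrite !inE spanK.
Qed.

End CriticalSubgraph.

(* For x < y, [line_adj x y] holds iff y = x + 1 or y = x + 2 mod 3; orienting
   the edges by residues turns both cases into the single inequality below. *)
Definition arc (x y : nat) : bool := (x == y + 1 %[mod 3]) && (x <= y.+1).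
Definition line_adj : rel nat := fun x y => arc x y || arc y x.

Lemma line_adj_no_P7 (p : 'I_7 -> nat) :
  ~ (forall i j, line_adj (p i) (p j) = path_rel i j).
Proof.
move=> pP.
have adjE i j (ltij : i < j) (lej : j < 7) :
    line_adj (p (inord i)) (p (inord j)) = (i.+1 == j).
  rewrite pP /path_rel !inordK //; last by lia.
  by case: eqP => //=; lia.
have: forall i, i < 7 -> exists q c, p (inord i) = 3 * q + c /\ c < 3.
  by move=> i _; exists (p (inord i) %/ 3), (p (inord i) %% 3); split; lia.
(* Splitting off residues turns the congruences into conditions that compute once the residues are
   numerals. *)
have lineE q c q' c' : c < 3 -> c' < 3 -> line_adj (3 * q + c) (3 * q' + c') =
   ((c == (c' + 1) %% 3) && (3 * q + c <= 3 * q' + c' + 1)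
   || (c' == (c + 1) %% 3) && (3 * q' + c' <= 3 * q + c + 1)).
  by move=> *; rewrite /line_adj /arc; lia.
move=> pE.
have [q0 [c0 [e0 l0]]] := pE 0 isT; have [q1 [c1 [e1 l1]]] := pE 1 isT.
have [q2 [c2 [e2 l2]]] := pE 2 isT; have [q3 [c3 [e3 l3]]] := pE 3 isT.
have [q4 [c4 [e4 l4]]] := pE 4 isT; have [q5 [c5 [e5 l5]]] := pE 5 isT.
have [q6 [c6 [e6 l6]]] := pE 6 isT.
have := adjE 0 1 isT isT. have := adjE 0 2 isT isT. have := adjE 0 3 isT isT.
have := adjE 0 4 isT isT. have := adjE 0 5 isT isT. have := adjE 0 6 isT isT.
have := adjE 1 2 isT isT. have := adjE 1 3 isT isT. have := adjE 1 4 isT isT.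
have := adjE 1 5 isT isT. have := adjE 1 6 isT isT. have := adjE 2 3 isT isT.
have := adjE 2 4 isT isT. have := adjE 2 5 isT isT. have := adjE 2 6 isT isT.
have := adjE 3 4 isT isT. have := adjE 3 5 isT isT. have := adjE 3 6 isT isT.
have := adjE 4 5 isT isT. have := adjE 4 6 isT isT. have := adjE 5 6 isT isT.
rewrite {adjE} e0 e1 e2 e3 e4 e5 e6 !lineE // {e0 e1 e2 e3 e4 e5 e6 pE lineE pP}.
(* With the residues fixed, each (non-)adjacency is linear in the quotients. *)
by case: c0 l0 => [|[|[|?]]] // _; case: c1 l1 => [|[|[|?]]] // _ //=;
  case: c2 l2 => [|[|[|?]]] // _ //=; case: c3 l3 => [|[|[|?]]] // _ //=;
  case: c4 l4 => [|[|[|?]]] // _ //=; case: c5 l5 => [|[|[|?]]] // _ //=;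
  case: c6 l6 => [|[|[|?]]] // _ //=; lia.
Qed.

Lemma line_adj_mod3 x y : line_adj x y -> x %% 3 <> y %% 3.
Proof. by rewrite /line_adj /arc; lia. Qed.

Section Circulant.
Variable r : nat.

(* For x < y the difference y - x is 1, or 2 mod 3, or the full 3r + 3 = -1. *)
Definition circulant_rel : rel 'I_(3 * r + 4) :=
  fun x y => [|| line_adj x y, x + (3 * r + 3) == y | y + (3 * r + 3) == x].

Lemma circulant_sym : symmetric circulant_rel.
Proof. by move=> x y; rewrite /circulant_rel /line_adj; lia. Qed.

Lemma circulant_irr : irreflexive circulant_rel.
Proof. by move=> x; rewrite /circulant_rel /line_adj /arc; lia. Qed.

Definition circulant : sgraph := SGraph circulant_sym circulant_irr.

Definition cut (v x : nat) : nat := if x < v then x + (3 * r + 4) else x.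

(** As 3r + 4 is 1 mod 3, replacing a difference d by 3r + 4 - d preserves the class of 2 mod 3 and
    exchanges 1 with 3r + 3. After the cut, the difference 3r + 3 no longer occurs. *)
Lemma line_adj_cut (v x y : circulant) :
  x != v -> y != v -> line_adj (cut v x) (cut v y) = edge x y.
Proof.
rewrite -!val_eqE /= /circulant_rel /cut /line_adj /arc.
move: (ltn_ord x) (ltn_ord y) (ltn_ord v).
by case: (ltnP x v); case: (ltnP y v); lia.
Qed.

(** With more than seven vertices, some [v] lies outside the path, and cutting there moves the path
    to the line. *)
Lemma circulant_free_P7 : 7 < 3 * r + 4 -> free (path_graph 7) circulant.
Proof.
move=> r_large [S [f [[g fK gK] fP]]].
have [v nSv] : exists v, v \notin S.
  apply/existsP; rewrite -negb_forall; apply/negP => /forallP allS.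
  suff: 3 * r + 4 <= 7 by lia.
  rewrite -[X in X <= _]card_ord -[X in _ <= X]card_ord.
  have h_inj : injective (fun x : circulant => f (exist _ x (allS x))).
    by move=> x y /(can_inj fK) [].
  exact: leq_card h_inj.
apply: (@line_adj_no_P7 (fun i => cut v (val (g i : induced S)))) => i j.
have ngv u : val (g u : induced S) != v.
  by apply: contraNneq nSv => <-; apply: valP.
by rewrite line_adj_cut //; have := fP (g i) (g j); rewrite !gK.
Qed.

Lemma circulant_not_3_colorable : ~ colorable 3 circulant.
Proof.
case=> c cP.
have vert i : i < 3 * r + 4 -> exists x : circulant, nat_of_ord x = i.
  by move=> lti; exists (Ordinal lti).
have neqc (x y : circulant) : edge x y -> nat_of_ord (c x) <> c y.
  by move=> /cP/eqP neq /val_inj.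
(* The vertices x + 1 and x + 2 have distinct colours and are both adjacent to x and to x + 3, which
   leaves a single colour for these two. *)
have shift3 (x y : circulant) : nat_of_ord y = x + 3 -> c y = c x.
  move=> yx; have lty := ltn_ord y.
  have [x1 e1] := vert (x + 1) ltac:(lia).
  have [x2 e2] := vert (x + 2) ltac:(lia).
  have close (u w : circulant) : u < w <= u + 2 -> nat_of_ord (c u) <> c w.
    move=> ltuw; apply: neqc.
    by rewrite /= /circulant_rel /line_adj /arc; lia.
  have := close x x1 ltac:(lia). have := close x x2 ltac:(lia).
  have := close x1 x2 ltac:(lia). have := close x1 y ltac:(lia).
  have := close x2 y ltac:(lia). move=> *; apply: val_inj => /=.
  move: (ltn_ord (c x)) (ltn_ord (c x1)) (ltn_ord (c x2)) (ltn_ord (c y)).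
  by lia.
have [x0 e0] := vert 0 ltac:(lia).
have const m (x : circulant) : nat_of_ord x = 3 * m -> c x = c x0.
  elim: m x => [|m IHm] x xm; first by congr c; apply: val_inj => /=; lia.
  have ltx := ltn_ord x; have [y ey] := vert (3 * m) ltac:(lia).
  by rewrite (shift3 y) ?IHm //; lia.
have [x xE] := vert (3 * r + 3) ltac:(lia).
apply: (neqc x0 x); last by rewrite (const r.+1) //; lia.
by rewrite /= /circulant_rel; lia.
Qed.

Lemma circulant_vertex_deletions_colorable :
  vertex_deletions_colorable 3 circulant.
Proof.
move=> v.
exists (fun x : circulant => Ordinal (ltn_pmod (cut v x) (isT : 0 < 3))).
move=> x y nxv nyv; rewrite -(line_adj_cut nxv nyv) => /line_adj_mod3 neq.
by apply/eqP => -[].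
Qed.

End Circulant.

Theorem lemma13 : infinitely_many_up_to_iso (critical_free 4 (path_graph 7)).
Proof.
(* The shift to [n.+2] ensures 3r + 4 > 7; distinct orders will exclude isomorphisms. *)
have critE n : exists G : sgraph,
    critical_free 4 (path_graph 7) G /\ #|G| = 3 * n.+2 + 4.
  rewrite -[3 * _ + 4]card_ord.
  apply: (exists_critical_free (G := circulant n.+2)).
  - by apply: circulant_free_P7; lia.
  - exact: circulant_not_3_colorable.
  - exact: circulant_vertex_deletions_colorable.
pose F n := constructive_indefinite_description _ (critE n).
exists (fun n => proj1_sig (F n)); split=> [n|m n nmn [f [/bij_eq_card]]].
  by have [] := proj2_sig (F n).
by rewrite (proj2 (proj2_sig (F m))) (proj2 (proj2_sig (F n))); lia.
Qed.
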